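(* For every constant $k$, there exists an algorithm which, given a finite argumentation framework $F=\langle\mathcal{A},\mathcal{R}\rangle$ whose in-degree is bounded by $k$ (that is, $|y^-|\le k$ for every $y\in\mathcal{A}$), decides in time polynomial in the size of $F$ whether $F$ is naive-bijective.
   Context: All objects are finite. An argumentation framework is a pair $F=\langle \mathcal{A},\mathcal{R}\rangle$ where $\mathcal{A}$ is a finite set (of arguments) and $\mathcal{R}\subseteq\mathcal{A}\times\mathcal{A}$ (attacks; self-attacks are allowed). Its size is the size of the directed graph $(\mathcal{A},\mathcal{R})$. For $S\subseteq\mathcal{A}$: $S^+=\{x\in\mathcal{A}\mid \exists y\in S,\ (y,x)\in\mathcal{R}\}$ and $S^-=\{x\in\mathcal{A}\mid \exists y\in S,\ (x,y)\in\mathcal{R}\}$; for $y\in\mathcal{A}$, $y^-=\{y\}^-$. A set $S\subseteq\mathcal{A}$ is conflict-free if $S\cap S^+=\emptyset$; naive sets are the inclusion-wise maximal conflict-free sets, forming the family $\mathrm{NAIV}(F)$. $S$ is admissible if it is conflict-free and self-defending, i.e. $S^-\subseteq S^+$. Preferred extensions are the inclusion-wise maximal admissible sets, forming the family $\mathrm{PREF}(F)$. $F$ is naive-bijective if $\mathrm{NAIV}(F)=\mathrm{PREF}(F)$. *)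

(* Defs.v *)
From mathcomp Require Import all_boot all_order all_algebra.
Set Implicit Arguments.
Unset Strict Implicit.
Unset Printing Implicit Defensive.

Record argfw := ArgFw {
  arg : finType;
  att : {set arg * arg}
}.

Section Semantics.
Variable F : argfw.
Implicit Type S : {set arg F}.

Definition attacked S : {set arg F} :=
  [set x | [exists y in S, (y, x) \in att F]].

Definition attackers S : {set arg F} :=
  [set x | [exists y in S, (x, y) \in att F]].

Definition conflict_free S : bool := S :&: attacked S == set0.

Definition admissible S : bool :=
  conflict_free S && (attackers S \subset attacked S).

Definition NAIV : {set {set arg F}} := [set S | maxset conflict_free S].

Definition PREF : {set {set arg F}} := [set S | maxset admissible S].

Definition naive_bijective : bool := NAIV == PREF.

Definition in_degree_bounded (k : nat) : bool :=
  [forall y : arg F, #|attackers [set y]| <= k].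

Definition af_size : nat := #|arg F| + #|att F|.

(* Arguments are named 0, ..., n-1 by [enum_rank]; the input word is
   n, m, u_1, v_1, ..., u_m, v_m, where n = #|arg F| and (u_i, v_i), i <= m,
   lists the attacks without repetition. *)
Definition af_code : seq nat :=
  [:: #|arg F|, #|att F|
    & flatten [seq [:: val (enum_rank e.1); val (enum_rank e.2)]
              | e <- enum (att F)]].

End Semantics.

(* The machine of Cook and Reckhow ("Time bounded random access machines",
   1973), on natural numbers with truncated subtraction.  Time is the number of
   executed instructions.  There is no multiplication, so a register grows by
   at most one bit per step: polynomial time for this unit cost coincides with
   polynomial time for the logarithmic cost and for Turing machines. *)
Inductive instr :=
  | Iconst of nat & nat
  | Iadd of nat & nat & nat
  | Isub of nat & nat & nat
  | Iload of nat & nat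
  | Istore of nat & nat
  | Ijpos of nat & nat
  | Iread of nat.

Definition program := seq instr.

Record config := Config {
  pc : nat;
  reg : nat -> nat;
  inp : seq nat
}.

Definition upd (m : nat -> nat) (a v : nat) : nat -> nat :=
  fun b => if b == a then v else m b.

Definition exec (i : instr) (c : config) : config :=
  let: Config q m w := c in
  match i with
  | Iconst i v => Config q.+1 (upd m i v) w
  | Iadd i j l => Config q.+1 (upd m i (m j + m l)) w
  | Isub i j l => Config q.+1 (upd m i (m j - m l)) w
  | Iload i j => Config q.+1 (upd m i (m (m j))) w
  | Istore i j => Config q.+1 (upd m (m i) (m j)) w
  | Ijpos j l => Config (if 0 < m j then l else q.+1) m w
  | Iread i => Config q.+1 (upd m i (head 0 w)) (behead w)
  end.

Definition halted (P : program) (c : config) : bool := size P <= pc c.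

(* A halted configuration is a fixed point, so that [halted] after [t]
   iterations means that the machine stops within [t] steps. *)
Definition step (P : program) (c : config) : config :=
  if onth P (pc c) is Some i then exec i c else c.

Definition init (w : seq nat) : config := Config 0 (fun=> 0) w.

(* The answer is read in X_0: 1 for yes, 0 for no. *)
Definition answers_within (t : nat) (P : program) (w : seq nat) (b : bool) :
    Prop :=
  let c := iter t (step P) (init w) in halted P c /\ reg c 0 = b.

(* Main.v *)
Require Import Defs.
From mathcomp Require Import all_boot all_order all_algebra.
From mathcomp Require Import zify.

(* A framework is naive-bijective iff every naive set is admissible.  If a naive
   set S contains y but is not defended against an attacker x of y, then S is
   disjoint from x^-, and by maximality every z in x^- attacks itself or is in
   conflict with some element of S.  One such element for each of the at most k
   attackers of x, together with y, is a conflict-free set that certifies the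
   failure, since any naive set containing it avoids x^-.  So the failure is a
   first-order property of the attack graph, and first-order sentences are
   evaluated in polynomial time by nested loops over the arguments. *)

Set Implicit Arguments.
Unset Strict Implicit.
Unset Printing Implicit Defensive.

Import GRing.Theory.

(** * A bounded certificate for the failure of naive-bijectivity *)

Section Criterion.
Variable F : argfw.
Implicit Types (S : {set arg F}) (x y z : arg F).

Lemma conflict_freeP S :
  reflect {in S &, forall x y, (x, y) \notin att F} (conflict_free S).
Proof.
apply: (iffP eqP) => [S0 x y Sx Sy|H].
  apply/negP => Rxy; suff: y \in S :&: attacked S by rewrite S0 inE.
  by rewrite !inE Sy; apply/existsP; exists x; rewrite Sx.
apply/setP=> y; rewrite !inE; apply/negP => /andP[Sy /existsP[x /andP[Sx]]].
by apply/negP; apply: H.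
Qed.

(** Admissible sets are conflict-free, so an admissible naive set is preferred. A preferred set
    extends to a naive set, which is admissible under the condition and thus equal to it. *)
Lemma naive_bijectiveE :
  naive_bijective F = [forall S, maxset (@conflict_free F) S ==> admissible S].
Proof.
apply/eqP/forallP => [E S|H].
  apply/implyP => mS; have: S \in PREF F by rewrite -E inE.
  by rewrite inE => /maxsetP[].
apply/setP=> S; rewrite !inE; apply/idP/idP => mS.
  apply/maxsetP; split; first exact: (implyP (H S)).
  by move=> B /andP[cB _]; case/maxsetP: mS => _; apply.
have /maxsetP[/andP[cS _] maxS] := mS.
have [B mB sSB] := maxset_exists cS.
by rewrite -(maxS B (implyP (H B) mB) sSB).
Qed.

Lemma naive_maximal S z : maxset (@conflict_free F) S -> z \notin S ->
  (z, z) \notin att F ->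
  exists2 u, u \in S & ((z, u) \in att F) || ((u, z) \in att F).
Proof.
case/maxsetP=> /conflict_freeP cS maxS nSz nzz.
apply/exists_inP; apply: contraNT nSz => /exists_inPn H.
rewrite -(maxS (z |: S)) ?setU11 ?subsetU1 //; apply/conflict_freeP => x y.
rewrite !inE => /predU1P[->|Sx] /predU1P[->|Sy] //; last exact: cS.
  by have := H _ Sy; rewrite negb_or => /andP[].
by have := H _ Sx; rewrite negb_or => /andP[].
Qed.

Lemma not_naive_bijectiveP k : in_degree_bounded F k ->
  ~~ naive_bijective F <->
  exists x y L, [/\ size L = k, (x, y) \in att F,
    {in y :: L &, forall u v, (u, v) \notin att F} &
    forall z, (z, x) \in att F -> (z, z) \notin att F ->
      exists2 u, u \in y :: L & ((z, u) \in att F) || ((u, z) \in att F)].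
Proof.
move/forallP=> degk; rewrite naive_bijectiveE; split; last first.
  case=> x [y [L [_ Rxy cL defL]]]; apply/forallPn.
  have cT : conflict_free [set u in y :: L].
    by apply/conflict_freeP => u v; rewrite !inE => Lu Lv; apply: cL; rewrite inE.
  have [S mS /subsetP sTS] := maxset_exists cT; exists S.
  rewrite mS; apply/negP=> /andP[/conflict_freeP cS /subsetP admS].
  have sL u : u \in y :: L -> u \in S by move=> Lu; apply: sTS; rewrite inE.
  (* An admissible [S] would contain some [z] attacking [x], but [z] is in conflict with a member of
     the certificate, which lies in [S]. *)
  have : x \in attacked S.
    by apply: admS; rewrite inE; apply/exists_inP; exists y; rewrite ?sL ?mem_head.
  rewrite inE => /exists_inP[z Sz Rzx].
  have [u /sL Su] := defL z Rzx (cS _ _ Sz Sz).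
  by rewrite (negPf (cS _ _ Sz Su)) (negPf (cS _ _ Su Sz)).
case/forallPn=> S; rewrite negb_imply => /andP[mS].
have cS : conflict_free S by case/maxsetP: mS.
rewrite /admissible cS => /subsetPn[x]; rewrite !inE => /exists_inP[y Sy Rxy].
move=> /exists_inPn nSx.
(* The default [y] is in [S], so [g z] is in [S] even for [z] without a conflict. *)
pose g z := odflt y [pick u in S | ((z, u) \in att F) || ((u, z) \in att F)].
have Sg z : g z \in S by rewrite /g; case: pickP => // u /andP[].
pose L := [seq g z | z <- enum (attackers [set x])].
have szL : size L <= k by rewrite size_map -cardE; apply: degk.
(* Copies of [y] pad the list to length exactly [k], so that a fixed number of quantifiers
   suffices. *)
exists x, y, (L ++ nseq (k - size L) y).
have sL u : u \in y :: L ++ nseq (k - size L) y -> u \in S.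
  rewrite !inE mem_cat => /predU1P[->//|/orP[/mapP[z _ ->]//|]].
  by rewrite mem_nseq => /andP[_ /eqP->].
split=> //; first by rewrite size_cat size_nseq subnKC.
  by move=> u v /sL Su /sL Sv; move/conflict_freeP: cS; apply.
move=> z Rzx nzz; exists (g z).
  rewrite inE mem_cat map_f ?orbT // mem_enum inE.
  by apply/exists_inP; exists x; rewrite ?inE.
have nSz : z \notin S by apply: contraTN Rzx => /nSx.
have [u Su Ru] := naive_maximal mS nSz nzz.
by rewrite /g; case: pickP => [v /andP[]//|/(_ u)]; rewrite Su Ru.
Qed.
End Criterion.

(** * Structured programs and their timed correctness rules *)

(* Structured programs; register [1] is the scratch register of the jumps. *)
Inductive cmd :=
  | Do of seq instr
  | Seq of cmd & cmd
  | When of nat & cmd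
  | While of nat & cmd.

(** Jump targets are absolute, hence the address [q] of the code. An unconditional jump first sets
    register 1 to 1; [While] has its test after the body. *)
Fixpoint compile (q : nat) (c : cmd) : program :=
  match c with
  | Do l => l
  | Seq c1 c2 => let l := compile q c1 in l ++ compile (q + size l) c2
  | When r c => let l := compile q.+3 c in
      [:: Ijpos r q.+3; Iconst 1 1; Ijpos 1 (q.+3 + size l)] ++ l
  | While r c => let l := compile q.+2 c in
      [:: Iconst 1 1; Ijpos 1 (q.+2 + size l)] ++ l ++ [:: Ijpos r q.+2]
  end.

Definition fits (P : program) (q : nat) (l : seq instr) :=
  forall i, i < size l -> onth P (q + i) = onth l i.

(** Total correctness with a time bound, for the code of [c] placed at any address of any
    program. *)
Definition wp t c (m : nat -> nat) w (Q : (nat -> nat) -> seq nat -> Prop) :=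
  forall P q, fits P q (compile q c) ->
  exists s m' w', [/\ s <= t,
    iter s (step P) (Config q m w) = Config (q + size (compile q c)) m' w'
    & Q m' w'].

Lemma fits_cat P q l1 l2 :
  fits P q (l1 ++ l2) -> fits P q l1 /\ fits P (q + size l1) l2.
Proof.
move=> H; split=> i lti.
  by rewrite H ?size_cat ?ltn_addr // onth_cat lti.
rewrite -addnA H ?size_cat ?ltn_add2l // onth_cat ltnNge leq_addr /=.
by rewrite addKn.
Qed.

Lemma fits_cons P q i l : fits P q (i :: l) -> onth P q = Some i /\ fits P q.+1 l.
Proof.
move=> H; split; first by have := H 0 isT; rewrite addn0.
by move=> j ltj; rewrite addSnnS H.
Qed.

Lemma wp_le t1 t2 c m w Q : t1 <= t2 -> wp t1 c m w Q -> wp t2 c m w Q.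
Proof.
move=> le12 H P q /H [s [m' [w' [les E Qm]]]].
by exists s, m', w'; split=> //; apply: leq_trans les le12.
Qed.

Lemma wp_mono t c m w (Q1 Q2 : (nat -> nat) -> seq nat -> Prop) :
  wp t c m w Q1 -> (forall m' w', Q1 m' w' -> Q2 m' w') -> wp t c m w Q2.
Proof.
move=> H QQ P q /H [s [m' [w' [les E Qm]]]].
by exists s, m', w'; split=> //; apply: QQ.
Qed.

Definition straight (i : instr) := if i is Ijpos _ _ then false else true.

Definition block (l : seq instr) (m : nat -> nat) (w : seq nat) :=
  foldl (fun c i => exec i c) (Config 0 m w) l.

Lemma step_onth P q m w i :
  onth P q = Some i -> step P (Config q m w) = exec i (Config q m w).
Proof. by rewrite /step /= => ->. Qed.

Lemma exec_straight i q m w : straight i ->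
  exec i (Config q m w) =
  Config q.+1 (reg (exec i (Config 0 m w))) (inp (exec i (Config 0 m w))).
Proof. by case: i. Qed.

Lemma block_pc q q' l m w : all straight l ->
  let f := foldl (fun c i => exec i c) in
  reg (f (Config q m w) l) = reg (f (Config q' m w) l) /\
  inp (f (Config q m w) l) = inp (f (Config q' m w) l).
Proof.
elim: l q q' m w => // i l IH q q' m w /= /andP[si sl].
by case: i si => //= *; apply: IH.
Qed.

Lemma wp_do l m w (Q : (nat -> nat) -> seq nat -> Prop) :
  all straight l -> Q (reg (block l m w)) (inp (block l m w)) ->
  wp (size l) (Do l) m w Q.
Proof.
move=> sl Qm P q; rewrite /= => fl.
exists (size l), (reg (block l m w)), (inp (block l m w)); split=> // {Qm}.
elim: l q m w sl fl => [|i l IH] q m w; first by rewrite addn0.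
case/andP=> si sl /fits_cons[Pi fl].
rewrite [size _]/= iterSr (step_onth _ _ Pi) (exec_straight _ _ _ si) IH //.
have -> : block (i :: l) m w = foldl (fun c i => exec i c) (exec i (Config 0 m w)) l.
  by [].
rewrite addSnnS (exec_straight 0 m w si).
by have [-> ->] := block_pc 0 1 (reg (exec i (Config 0 m w)))
  (inp (exec i (Config 0 m w))) sl.
Qed.

Lemma wp_seq t1 t2 c1 c2 m w Q :
  wp t1 c1 m w (fun m' w' => wp t2 c2 m' w' Q) -> wp (t1 + t2) (Seq c1 c2) m w Q.
Proof.
move=> H P q /= /fits_cat[/H[s1 [m1 [w1 [les1 E1 H1]]]] /H1].
move=> [s2 [m2 [w2 [les2 E2 Qm]]]].
exists (s2 + s1), m2, w2; split=> //; first by lia.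
by rewrite iterD E1 E2 size_cat addnA.
Qed.

(** Skipping the body takes three instructions and leaves 1 in register 1; entering it takes one. *)
Lemma wp_when t r c m w (Q : (nat -> nat) -> seq nat -> Prop) :
  (0 < m r -> wp t c m w Q) -> (m r = 0 -> Q (upd m 1 1) w) ->
  wp (t + 3) (When r c) m w Q.
Proof.
move=> H1 H0 P q; rewrite /= => /fits_cons[P0 /fits_cons[P1 /fits_cons[P2 fc]]].
case: (posnP (m r)) => mr.
  exists 3, (upd m 1 1), w; split; [by lia| |exact: H0].
  rewrite /iter (step_onth _ _ P0) /= mr /= (step_onth _ _ P1) /=.
  by rewrite (step_onth _ _ P2) /= /upd /= !addnS.
have [s [m' [w' [les E Qm]]]] := H1 mr P q.+3 fc.
exists (s + 1), m', w'; split=> //; first by lia.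
by rewrite iterD /= (step_onth _ _ P0) /= mr E !addnS.
Qed.

(** The invariant is indexed by the loop register, that is, by the number of passes left. Each pass
    pays one test; the 3 counts the two entry instructions and the last test. *)
Lemma wp_while (I : nat -> (nat -> nat) -> seq nat -> Prop) t N r c m w :
  (forall j m w, I j m w -> m r = j) ->
  (forall j m w, j < N -> I j.+1 m w -> wp t c m w (I j)) ->
  I N (upd m 1 1) w ->
  wp (N * t.+1 + 3) (While r c) m w (I 0).
Proof.
move=> Ir Ic IN P q; rewrite /= => /fits_cons[P0 /fits_cons[P1 /fits_cat[fc]]].
case/fits_cons=> P2 _; set q' := q.+2 + _ in P1 P2.
have loop j m1 w1 : j <= N -> I j m1 w1 -> exists s m' w',
    [/\ s <= j * t.+1 + 1,
      iter s (step P) (Config q' m1 w1) = Config q'.+1 m' w' & I 0 m' w'].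
  elim: j m1 w1 => [|j IH] m1 w1 lej Ij.
    exists 1, m1, w1; split=> //.
    by rewrite /iter (step_onth _ _ P2) /= (Ir _ _ _ Ij).
  have [s1 [m2 [w2 [les1 E1 I2]]]] := Ic _ _ _ lej Ij P q.+2 fc.
  have [s2 [m3 [w3 [les2 E2 I3]]]] := IH _ _ (ltnW lej) I2.
  exists (s2 + (s1 + 1)), m3, w3; split=> //; first by lia.
  by rewrite !iterD /= (step_onth _ _ P2) /= (Ir _ _ _ Ij) E1 E2.
have [s [m' [w' [les E I0]]]] := loop N _ _ (leqnn N) IN.
exists (s + 2), m', w'; split=> //; first by lia.
rewrite iterD /= (step_onth _ _ P0) /= (step_onth _ _ P1) /= E.
by rewrite size_cat /= /q' addn1 !addnS !addSn.
Qed.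

(** * First-order formulas over the attack graph *)

(* Variables are de Bruijn indices. *)
Inductive formula :=
  | Att of nat & nat
  | Not of formula
  | And of formula & formula
  | Ex of formula.

Definition scons (v : nat) (e : nat -> nat) : nat -> nat :=
  fun i => if i is j.+1 then e j else v.

Fixpoint holds (n : nat) (A : rel nat) (e : nat -> nat) (f : formula) : bool :=
  match f with
  | Att i j => A (e i) (e j)
  | Not f => ~~ holds n A e f
  | And f g => holds n A e f && holds n A e g
  | Ex f => has (fun v => holds n A (scons v e) f) (iota 0 n)
  end.

Lemma eq_holds n A e1 e2 f : e1 =1 e2 -> holds n A e1 f = holds n A e2 f.
Proof.
elim: f e1 e2 => [i j|f IH|f IHf g IHg|f IH] e1 e2 ee /=.
- by rewrite !ee.
- by rewrite (IH _ _ ee).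
- by rewrite (IHf _ _ ee) (IHg _ _ ee).
- by apply: eq_has => v; apply: IH => -[].
Qed.

Definition edge_rel (es : seq (nat * nat)) : rel nat :=
  fun u v => (u, v) \in es.

(** * Evaluation of formulas on an encoded graph *)

Definition word n (es : seq (nat * nat)) :=
  [:: n, size es & flatten [seq [:: e.1; e.2] | e <- es]].

Definition loaded B w (m : nat -> nat) :=
  forall i, i < size w -> m (B + i) = nth 0 w i.

(* Subtraction is truncated: register [7] receives [|u - x| + |v - y|] for the
   edge [(u, v)] held in registers [5] and [6]. *)
Definition match_edge (x y : nat) : cmd :=
  Seq (Do [:: Isub 7 5 x; Isub 8 x 5; Iadd 7 7 8])
 (Seq (Do [:: Isub 8 6 y; Iadd 7 7 8; Isub 8 y 6; Iadd 7 7 8])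
      (Do [:: Isub 8 2 7; Iadd 0 0 8])).

(** Register 4 points into the edge list, 3 counts the edges left and 0 the matches. Subtracting
    twice from 1 turns the count into a truth value. *)
Definition scan (B x y : nat) : cmd :=
  Seq (Do [:: Iconst 2 1; Iconst 0 0; Iadd 3 B.+1 0; Iconst 4 B.+2])
 (Seq (While 3
        (Seq (Do [:: Iload 5 4; Iadd 4 4 2; Iload 6 4; Iadd 4 4 2; Isub 3 3 2])
             (match_edge x y)))
      (Do [:: Isub 0 2 0; Isub 0 2 0])).

(* Registers [0, ..., 8] are scratch; the stack of variables lies above them. *)
Definition slot a := a.+4.+4.+1.

(* The input word starts at [slot b], and the stack grows downwards from
   [slot s]: variable [i] is at [slot (s + 2 i + 1)], and [slot (s + 2 i)] counts
   the values of that variable found to satisfy the body of its quantifier.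
   The code for a formula changes no register from [slot s] on. *)
Fixpoint eval (b s : nat) (f : formula) : cmd :=
  match f with
  | Att i j => scan (slot b) (slot (s + i.*2).+1) (slot (s + j.*2).+1)
  | Not f => Seq (eval b s f) (Do [:: Iconst 2 1; Isub 0 2 0])
  | And f g => Seq (eval b s f) (When 0 (eval b s g))
  | Ex f => let s' := s.-2 in
      Seq (Do [:: Iconst (slot s') 0; Iadd (slot s'.+1) (slot b) (slot s')])
     (Seq (While (slot s'.+1)
            (Seq (Do [:: Iconst 2 1; Isub (slot s'.+1) (slot s'.+1) 2])
            (Seq (eval b s' f)
                 (Do [:: Iadd (slot s') (slot s') 0]))))
          (Do [:: Iconst 2 1; Isub 0 2 (slot s'); Isub 0 2 0]))
  end.

(** The stack space needed: two cells per nested quantifier, shared between conjuncts. *)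
Fixpoint height (f : formula) : nat :=
  match f with
  | Att _ _ => 0
  | Not f => height f
  | And f g => maxn (height f) (height g)
  | Ex f => (height f).+2
  end.

(** A time bound, to be evaluated at a common bound of [n] and the number of edges; the loop of each
    quantifier contributes a factor ['X]. *)
Fixpoint cost (f : formula) : {poly nat} :=
  match f with
  | Att _ _ => 15%:P * 'X + 9%:P
  | Not f => cost f + 2%:P
  | And f g => cost f + cost g + 3%:P
  | Ex f => 'X * (cost f + 4%:P) + 8%:P
  end%R.

Definition env s (m : nat -> nat) : nat -> nat := fun i => m (slot (s + i.*2).+1).

Definition agree a0 (m m' : nat -> nat) := forall a, a0 <= a -> m' a = m a.

Lemma size_word n es : size (word n es) = (size es).*2.+2.
Proof. by rewrite /word /=; elim: es => //= e es; case=> ->. Qed.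

Lemma nth_word n es i : i < size es ->
  (nth 0 (word n es) i.*2.+2, nth 0 (word n es) i.*2.+3) = nth (0, 0) es i.
Proof.
rewrite /=; elim: es i => //= [[u v] es] IH [|i] //=.
by rewrite ltnS => /IH.
Qed.

Lemma loaded_agree B w a0 m m' :
  a0 <= B -> agree a0 m m' -> loaded B w m -> loaded B w m'.
Proof. by move=> leB ag ld i lti; rewrite ag ?ld // (leq_trans leB) ?leq_addr. Qed.

Lemma agree_upd a0 a v m m' : a < a0 -> agree a0 m m' -> agree a0 m (upd m' a v).
Proof.
by move=> lta ag a' lea; rewrite /upd gtn_eqF ?ag // (leq_trans lta lea).
Qed.

Lemma wp_match_edge x y m w : m 2 = 1 ->
  wp 9 (match_edge (slot x) (slot y)) m w (fun m' _ =>
    [/\ m' 2 = 1, m' 3 = m 3 & m' 4 = m 4] /\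
    (m' 0 = m 0 + ((m 5, m 6) == (m (slot x), m (slot y))) /\ agree 9 m m')).
Proof.
move=> m2; apply: (@wp_seq 3 6); apply: (wp_do (l := [:: _; _; _])) => //.
rewrite [inp _]/=; set m1 := reg _.
have ag1 : agree 9 m m1 by do ?apply: agree_upd.
have e1 : m1 7 = m 5 - m (slot x) + (m (slot x) - m 5) by [].
have e1' : [/\ m1 0 = m 0, m1 2 = 1, m1 3 = m 3, m1 4 = m 4 & m1 6 = m 6] by [].
clearbody m1; case: e1' => e10 e12 e13 e14 e16.
apply: (@wp_seq 4 2); apply: (wp_do (l := [:: _; _; _; _])) => //.
rewrite [inp _]/=; set m2' := reg _.
have ag2 : agree 9 m m2' by do ?apply: agree_upd.
have e2 : m2' 7 = m1 7 + (m1 6 - m1 (slot y)) + (m1 (slot y) - m1 6) by [].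
have e2' : [/\ m2' 0 = m 0, m2' 2 = 1, m2' 3 = m 3 & m2' 4 = m 4] by [].
clearbody m2'; case: e2' => e20 e22 e23 e24.
apply: (wp_do (l := [:: _; _])) => //=; split; first by [].
split; last by do ?apply: agree_upd.
rewrite /upd /= e20 e22 e2 e1 e16 xpair_eqE (ag1 (slot y)) //; congr (_ + _).
lia.
Qed.

Lemma wp_scan b x y m w n es : loaded (slot b) (word n es) m ->
  wp (15 * size es + 9) (scan (slot b) (slot x) (slot y)) m w
    (fun m' _ => m' 0 = edge_rel es (m (slot x)) (m (slot y)) /\ agree 9 m m').
Proof.
move=> ld; set N := size es; pose P e := e == (m (slot x), m (slot y)).
(* With [j] edges left, register 0 holds the number of matches among the first [N - j]. *)
pose I j (m' : nat -> nat) (_ : seq nat) :=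
  [/\ j <= N, m' 2 = 1, m' 3 = j & m' 4 = slot b + (N - j).*2.+2] /\
  (m' 0 = count P (take (N - j) es) /\ agree 9 m m').
(* Each edge costs 5 steps to load, 9 to compare and 1 to test the loop. *)
have t_le : 4 + (N * 15 + 3 + 2) <= 15 * N + 9 by lia.
apply: wp_le t_le _; apply: wp_seq; apply: (wp_do (l := [:: _; _; _; _])) => //.
apply: wp_seq; apply: (@wp_mono _ _ _ _ (I 0)); last first.
  move=> m' w' [[_ m2 _ _] [m0 ag]].
  apply: (wp_do (l := [:: _; _])) => //=.
  split; last by do ?apply: agree_upd.
  rewrite /upd /= m2 m0 subn0 take_size /edge_rel -has_pred1 has_count.
  by rewrite -/P; case: (count _ _) => [|[]].
apply: (@wp_while I 14) => [j m' w' [[_ _ -> _] _] //|j m' w' ltj|].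
  case=> -[_ m2 m3 m4] [m0 ag].
  apply: (@wp_seq 5 9); apply: (wp_do (l := [:: _; _; _; _; _])) => //.
  rewrite [inp _]/=; set m1 := reg _.
  have ag1 : agree 9 m m1 by do ?apply: agree_upd.
  have e1 : [/\ m1 0 = m' 0, m1 2 = m' 2, m1 3 = m' 3 - m' 2 &
    m1 4 = m' 4 + m' 2 + m' 2] by [].
  have [e5 e6] : m1 5 = m' (m' 4) /\ m1 6 = m' (m' 4 + m' 2).
    split; first by [].
    by rewrite /m1 /= /upd /= m2 m4.
  clearbody m1; case: e1; rewrite m2 m3 m4 => e10 e12 e13 e14.
  apply: wp_mono (@wp_match_edge x y _ w' e12) _ => m'' w'' [[f2 f3 f4] [f0 ag2]].
  split; first split=> //; try lia.
  split; last by move=> a lea; rewrite ag2 // ag1.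
  rewrite f0 e5 e6 e10 m0 m2 m4.
  have lti : N - j.+1 < N by lia.
  rewrite -(subnSK ltj) (take_nth (0, 0)) // -cats1 count_cat.
  rewrite [count _ [:: _]]/= addn0.
  rewrite /P -(nth_word n lti) !ag1 // !ag; try (by rewrite /slot; lia).
  by rewrite -addnA addn1 !ld ?size_word; try lia.
split; last (split; last by do ?apply: agree_upd).
  split; rewrite //= /upd /= ?subnn ?addn2 //.
  by rewrite addn0 -addn1 ld ?size_word.
by rewrite subnn take0.
Qed.

Lemma slot_le s b : (slot s <= slot b) = (s <= b).
Proof. by []. Qed.

Lemma agree_trans a0 m1 m2 m3 : agree a0 m1 m2 -> agree a0 m2 m3 -> agree a0 m1 m3.
Proof. by move=> ag1 ag2 a lea; rewrite ag2 ?ag1. Qed.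

Lemma agree_le a0 a1 m m' : a0 <= a1 -> agree a0 m m' -> agree a1 m m'.
Proof. by move=> le01 ag a lea; rewrite ag // (leq_trans le01). Qed.

Lemma env_agree s m m' : agree (slot s) m m' -> env s m' =1 env s m.
Proof. by move=> ag i; rewrite /env ag // slot_le -addnS leq_addr. Qed.

(** [height f <= s] leaves room for the stack above the scratch registers, and [s <= b] keeps it
    below the input word. Agreement from [slot s] on carries both the word and the variables past
    each subprogram. *)
Lemma wp_eval f n es b s m w N : n <= N -> size es <= N -> height f <= s -> s <= b ->
  loaded (slot b) (word n es) m ->
  wp (cost f).[N]%R (eval b s f) m w (fun m' _ =>
    m' 0 = holds n (edge_rel es) (env s m) f /\ agree (slot s) m m').
Proof.
move=> len lees; elim: f s m w => [i j|f IH|f IHf g IHg|f IH] s m w /= hs sb ld.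
- rewrite !(hornerD, hornerM, hornerX, hornerC) !natrE.
  apply: (@wp_le (15 * size es + 9)); first by lia.
  apply: wp_mono (@wp_scan b _ _ _ w n _ ld) _ => m' w' [-> ag]; split=> //.
  exact: agree_le ag.
- rewrite !(hornerD, hornerM, hornerX, hornerC) !natrE; apply: wp_seq.
  apply: wp_mono (IH s m w hs sb ld) _ => m' w' [m0 ag].
  apply: (wp_do (l := [:: _; _])) => //=; split; last by do ?apply: agree_upd.
  by rewrite /upd /= m0; case: holds.
- rewrite !(hornerD, hornerM, hornerX, hornerC) !natrE -addnA; apply: wp_seq.
  have [hf hg] : height f <= s /\ height g <= s by apply/andP; rewrite -geq_max.
  apply: wp_mono (IHf s m w hf sb ld) _ => m' w' [m0 ag].
  have ld' := loaded_agree _ ag ld.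
  apply: wp_when; rewrite m0.
    case: holds => // _.
    apply: wp_mono (IHg s m' w' hg sb (ld' _)) _ => // m'' w'' [m0' ag'].
    by split; [rewrite m0' (eq_holds _ _ _ (env_agree ag)) | apply: agree_trans ag'].
  case E: (holds n _ _ f) => // _; split; last exact: agree_upd.
  by rewrite /upd /= m0 E.
case: s hs sb => [|[|s]] //=; rewrite !ltnS => hs sb.
rewrite !(hornerD, hornerM, hornerX, hornerC) !natrE.
set c := (cost f).[N]%R in IH *.
pose e := env s.+2 m; pose P v := holds n (edge_rel es) (scons v e) f.
(* The loop register is also the quantified variable: decremented before the body, it runs from
   [n - 1] down to 0, so at [j] the values from [j] on have been tested. *)
pose I j (m' : nat -> nat) (_ : seq nat) :=
  [/\ j <= n, m' (slot s.+1) = j, m' (slot s) = count P (iota j (n - j))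
   & agree (slot s.+2) m m'].
apply: (@wp_le (2 + (n * (2 + (c + 1)).+1 + 3 + 3))).
  have := leq_mul2r (c + 4) n N; rewrite len orbT; lia.
apply: wp_seq; apply: (wp_do (l := [:: _; _])) => //.
apply: wp_seq; apply: (@wp_mono _ _ _ _ (I 0)); last first.
  move=> m' w' [_ _ mc ag].
  apply: (wp_do (l := [:: _; _; _])) => //=.
  split; last by do ?apply: agree_upd.
  rewrite /upd /= mc subn0 has_count -/P.
  by case: (count _ _) => [|[]].
apply: (@wp_while I (2 + (c + 1))) => [j m' w' [] //|j m' w' ltj|].
  case=> _ mv mc ag.
  apply: wp_seq; apply: (wp_do (l := [:: _; _])) => //.
  rewrite [inp _]/=; set m1 := reg _.
  have ag1 : agree (slot s.+2) m m1 by do ?apply: agree_upd.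
  have e1 : m1 (slot s.+1) = j by rewrite /m1 /= /upd /= eqxx mv subn1.
  have e2 : m1 (slot s) = m' (slot s) by rewrite /m1 /= /upd /= ltn_eqF.
  clearbody m1; apply: wp_seq.
  have ld1 : loaded (slot b) (word n es) m1 by apply: loaded_agree ag1 ld.
  apply: wp_mono (IH s m1 w' hs _ ld1) _; first by lia.
  move=> m2 w2 [m20 ag2].
  apply: (wp_do (l := [:: _])) => //=.
  have lesv : slot s <= slot s.+1 by [].
  split; first exact: ltnW.
  - by rewrite /upd /= gtn_eqF // ag2.
  - rewrite /upd /= eqxx ag2 // e2 mc -(subnSK ltj) /= addnC m20; congr (_ + _).
    congr nat_of_bool; apply: eq_holds => -[|i]; rewrite /env /=.
      by rewrite addn0.
    rewrite /e /env -ag1; last by rewrite slot_le; lia.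
    by congr (m1 (slot _)); lia.
  - apply: agree_upd; first by rewrite /slot; lia.
    by apply: agree_trans ag1 (agree_le _ ag2); rewrite /slot; lia.
split=> //.
- rewrite /= /upd /= !eqxx gtn_eqF ?addn0; last by rewrite /slot; lia.
  by have := ld 0 isT; rewrite addn0.
- by rewrite subnn /= /upd /= ltn_eqF // eqxx.
- by do ?apply: agree_upd.
Qed.

(** * Reading the input and deciding a formula *)

Definition read_word (B : nat) : cmd :=
  Seq (Do [:: Iread B; Iread B.+1; Iconst 2 1; Iadd 3 B.+1 B.+1; Iconst 4 B.+2])
      (While 3 (Do [:: Iread 5; Istore 4 5; Iadd 4 4 2; Isub 3 3 2])).

Lemma wp_read_word b n es m :
  wp (10 * size es + 8) (read_word (slot b)) m (word n es)
    (fun m' _ => loaded (slot b) (word n es) m').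
Proof.
set W := word n es; set N := size es.
(* With [j] numbers left to read, the two header entries and the first [N.*2 - j] endpoints are in
   place. *)
pose I j (m' : nat -> nat) w' :=
  [/\ j <= N.*2, m' 2 = 1, m' 3 = j & m' 4 = slot b + (N.*2 - j).+2] /\
  (w' = drop (N.*2 - j).+2 W /\
   forall i, i < (N.*2 - j).+2 -> m' (slot b + i) = nth 0 W i).
apply: (@wp_le (5 + (N.*2 * 5 + 3))); first by lia.
apply: wp_seq; apply: (wp_do (l := [:: _; _; _; _; _])) => //.
apply: (@wp_mono _ _ _ _ (I 0)); last first.
  by move=> m' w' [_ [_ H]] i; rewrite size_word => lti; rewrite H ?subn0.
apply: (@wp_while I 4) => [j m' w' [[_ _ -> _] _] //|j m' w' ltj|].
  case=> -[_ m2 m3 m4] [ww H].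
  have pj : (N.*2 - j) = (N.*2 - j.+1).+1 by lia.
  apply: (wp_do (l := [:: _; _; _; _])) => //=; rewrite /upd /= m2 m3 m4.
  (* The cell written lies above the scratch registers, so the store leaves them intact. *)
  have -> : 4 == slot b + (N.*2 - j.+1).+2 = false by rewrite /slot; lia.
  have -> : 2 == slot b + (N.*2 - j.+1).+2 = false by rewrite /slot; lia.
  have -> : 3 == slot b + (N.*2 - j.+1).+2 = false by rewrite /slot; lia.
  split; first by split; rewrite /= ?m2 ?m3 ?m4 ?subn1 //; lia.
  rewrite ww -drop1 drop_drop pj add1n; split=> // i lti.
  have -> : slot b + i == 3 = false by rewrite /slot; lia.
  have -> : slot b + i == 4 = false by rewrite /slot; lia.
  have -> : slot b + i == 5 = false by rewrite /slot; lia.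
  rewrite eqn_add2l; case: eqP => [->|/eqP ni]; last by apply: H; lia.
  by rewrite -nth0 nth_drop addn0.
split; rewrite subnn; last split.
- by rewrite /= /upd /= eqxx ?addn2 addnn; split.
- by rewrite /W /= drop0.
by case=> [|[|i]] // _; rewrite /= /upd /= ?addn0 ?addn1 eqxx ?ltn_eqF.
Qed.

(* Nothing is claimed about the values [e] of the free variables, which are
   whatever the registers contain. *)
Lemma formula_decidable f : exists (P : program) (p : {poly nat}),
  forall n es, exists e,
    answers_within p.[n + size es]%R P (word n es) (holds n (edge_rel es) e f).
Proof.
pose h := height f; pose c := Seq (read_word (slot h)) (eval h h f).
exists (compile 0 c), (10%:P * 'X + 8%:P + cost f)%R => n es.
set N := n + size es; have [len lees] : n <= N /\ size es <= N by rewrite /N; lia.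
pose t := (10 * size es + 8 + (cost f).[N]%R).
have : wp t c (fun=> 0) (word n es) (fun m' _ =>
    exists e, m' 0 = holds n (edge_rel es) e f).
  apply: wp_seq; apply: wp_mono (@wp_read_word h n es _) _ => m w ld.
  apply: wp_mono (wp_eval w len lees (leqnn h) (leqnn h) ld) _ => m' w' [m0 _].
  by exists (env h m).
case/(_ (compile 0 c) 0 (fun _ _ => erefl)) => s [m' [w' [les E [e m0]]]].
exists e; rewrite /answers_within -(@subnK s _.[_]%R); last first.
  rewrite !(hornerD, hornerM, hornerX, hornerC) !natrE.
  apply: leq_trans les _; rewrite /t leq_add2r; lia.
rewrite iterD E add0n.
(* A halted configuration is fixed, so the steps left over change nothing. *)
elim: (_ - s) => [|j [IH1 IH2]]; first by rewrite /= /halted leqnn.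
have st d P : halted P d -> step P d = d.
  by move=> hd; rewrite /step onth_default.
by rewrite iterS st.
Qed.

(** * The failure of naive-bijectivity as a sentence *)

Lemma holds_foldr_And n A e f l :
  holds n A e (foldr And f l) = all (holds n A e) l && holds n A e f.
Proof. by elim: l => //= g l ->; rewrite andbA. Qed.

(** The innermost quantifier binds the head of [s], so the outermost value is appended at the
    end. *)
Lemma holds_iter_Ex n A j e f : holds n A e (iter j Ex f) <->
  exists s, [/\ size s = j, all (gtn n) s & holds n A (foldr scons e s) f].
Proof.
elim: j e => [|j IH] e.
  by split=> [H|[s [/size0nil ->]]] //; exists [::].
rewrite iterS /=; split.
  case/hasP=> v; rewrite mem_iota /= => ltv /IH[s [<- sn H]].
  by exists (rcons s v); rewrite size_rcons all_rcons foldr_rcons /= ltv sn.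
case=> s; case/lastP: s => [[]//|s v]; rewrite size_rcons all_rcons foldr_rcons.
case=> -[sj] /andP[/= ltv sn] H; apply/hasP; exists v; first by rewrite mem_iota.
by apply/IH; exists s.
Qed.

Lemma foldr_scons e s i : i < size s -> foldr scons e s i = nth 0 s i.
Proof. by elim: s i => //= v s IH [|i] //=; apply: IH. Qed.

(* Variable [0] is an attacker [x] of [y], and variables [1, ..., k + 1] are [y]
   and the [k] elements in conflict with the attackers of [x]; the quantifier of
   [uncovered] shifts them by one. *)
Definition undefended (k : nat) : formula :=
  let I := iota 0 k.+1 in
  let uncovered := Ex (foldr And (And (Att 0 1) (Not (Att 0 0)))
    [seq And (Not (Att 0 i.+2)) (Not (Att i.+2 0)) | i <- I]) in
  foldr And (And (Att 0 1) (Not uncovered))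
    [seq Not (Att i.+1 j.+1) | i <- I, j <- I].

Definition not_naive_bijective (k : nat) : formula :=
  iter k.+1 Ex (Ex (undefended k)).

Definition edges (F : argfw) : seq (nat * nat) :=
  [seq (val (enum_rank e.1), val (enum_rank e.2)) | e <- enum (att F)].

Lemma af_codeE F : af_code F = word #|arg F| (edges F).
Proof. by rewrite /af_code /word size_map -cardE -map_comp. Qed.

Lemma edge_rel_rank F (x y : arg F) :
  edge_rel (edges F) (enum_rank x) (enum_rank y) = ((x, y) \in att F).
Proof.
rewrite -mem_enum.
apply: (mem_map (f := fun e => (val (enum_rank e.1), _)) _ _ (x, y)).
by move=> [a b] [c d] [/val_inj/enum_rank_inj -> /val_inj/enum_rank_inj ->].
Qed.

Lemma rank_onto (T : finType) v : v < #|T| -> exists x : T, v = enum_rank x.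
Proof. by move=> lt; exists (enum_val (Ordinal lt)); rewrite enum_valK. Qed.

Lemma holds_undefended k (F : argfw) (x y : arg F) L (e : nat -> nat) :
  size L = k -> (forall i, i < k.+1 -> e i = enum_rank (nth y (y :: L) i)) ->
  holds #|arg F| (edge_rel (edges F)) (scons (enum_rank x) e) (undefended k) <->
  [/\ (x, y) \in att F,
    {in y :: L &, forall u v, (u, v) \notin att F} &
    forall z, (z, x) \in att F -> (z, z) \notin att F ->
      exists2 u, u \in y :: L & ((z, u) \in att F) || ((u, z) \in att F)].
Proof.
set n := #|arg F|; set A := edge_rel _.
have AR (u v : arg F) : A (enum_rank u) (enum_rank v) = ((u, v) \in att F).
  exact: edge_rel_rank.
rewrite /undefended => szL eE; set x' := enum_rank x.
have : forall i, (i \in iota 0 k.+1) = (i < k.+1) by move=> i; rewrite mem_iota.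
(* Only membership in the index list matters; abstracting it keeps the conjunctions folded. *)
move: (iota 0 k.+1) => I memI.
have ySz : size (y :: L) = k.+1 by rewrite /= szL.
have AE i j : i < k.+1 -> j < k.+1 ->
    A (e i) (e j) = ((nth y (y :: L) i, nth y (y :: L) j) \in att F).
  by move=> lti ltj; rewrite !eE // AR.
have Axy : A x' (e 0) = ((x, y) \in att F) by rewrite eE // AR.
rewrite holds_foldr_And [holds _ _ _ (And _ _)]/= Axy.
have cE : all (holds n A (scons x' e))
    [seq Not (Att i.+1 j.+1) | i <- I, j <- I] <->
    {in y :: L &, forall u v, (u, v) \notin att F}.
  split=> [/all_allpairsP H u v /(nthP y)[i + <-] /(nthP y)[j + <-]|H].
    by rewrite ySz => lti ltj; rewrite -AE //; apply: H; rewrite memI.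
  apply/all_allpairsP=> i j; rewrite !memI => lti ltj /=.
  by rewrite AE // H // mem_nth ?ySz.
(* Every [v < n] is the rank of some [z], and the failure of all non-conflict clauses is a conflict
   with a member of [y :: L]. *)
have dE : (forall v, v < n -> ~~ holds n A (scons v (scons x' e))
    (foldr And (And (Att 0 1) (Not (Att 0 0)))
      [seq And (Not (Att 0 i.+2)) (Not (Att i.+2 0)) | i <- I])) <->
  forall z, (z, x) \in att F -> (z, z) \notin att F ->
    exists2 u, u \in y :: L & ((z, u) \in att F) || ((u, z) \in att F).
  split=> H.
    move=> z Rzx nzz; have := H _ (ltn_ord (enum_rank z)).
    rewrite holds_foldr_And /= !AR Rzx nzz !andbT -has_predC has_map.
    case/hasP=> i; rewrite memI => lti /=.
    rewrite -negb_or negbK eE // !AR => Ru.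
    by exists (nth y (y :: L) i); rewrite ?mem_nth ?ySz.
  move=> _ /rank_onto[z ->]; rewrite holds_foldr_And /= !AR.
  rewrite all_map; apply/negP=> /and3P[/allP nu Rzx nzz].
  have [_ /(nthP y)[i + <-] Ru] := H z Rzx nzz; rewrite ySz => lti.
  by have := nu i; rewrite memI lti /= eE // !AR -negb_or Ru => /(_ isT).
split.
  case/and3P=> /cE ? ? /hasPn nd; split=> //; apply/dE => v ltv.
  by apply: nd; rewrite mem_iota.
case=> -> /cE -> /dE nd; apply/hasPn => v; rewrite mem_iota; exact: nd.
Qed.

(** The outer [k + 1] quantifiers bind the ranks of [y :: L] and the innermost that of [x]. Every
    number below [#|arg F|] is a rank, so witnesses decode to arguments; the sentence is closed, so
    [e] is arbitrary. *)
Lemma holds_not_naive_bijective k (F : argfw) e : in_degree_bounded F k ->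
  holds #|arg F| (edge_rel (edges F)) e (not_naive_bijective k) =
  ~~ naive_bijective F.
Proof.
move=> degk; apply/idP/idP.
  move/holds_iter_Ex=> [s [sk sn]] /hasP[v].
  rewrite mem_iota add0n => /andP[_ /rank_onto[x ->]].
  case: s sk sn => [//|v0 s] [sk] /andP[/rank_onto[y ->] sn].
  have [L sE]: exists L : seq (arg F), s = [seq val (enum_rank u) | u <- L].
    elim: s sn {sk} => [|w s IH] /=; first by exists [::].
    by case/andP=> /rank_onto[u ->] /IH[L ->]; exists (u :: L).
  rewrite {}sE size_map in sk *.
  pose e' := foldr scons e [seq val (enum_rank u) | u <- y :: L].
  have e'E i : i < k.+1 -> e' i = enum_rank (nth y (y :: L) i).
    by move=> lti; rewrite /e' foldr_scons ?size_map ?(nth_map y) /= ?sk.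
  move/(holds_undefended x (y := y) (e := e') sk e'E) => [Rxy cL defL].
  by apply/(not_naive_bijectiveP degk); exists x, y, L.
case/(not_naive_bijectiveP degk) => x [y [L [szL Rxy cL defL]]].
apply/holds_iter_Ex; exists [seq val (enum_rank u) | u <- y :: L]; split.
- by rewrite size_map /= szL.
- by apply/allP=> _ /mapP[u _ ->]; apply: ltn_ord.
apply/hasP; exists (val (enum_rank x)); first by rewrite mem_iota ltn_ord.
apply/(holds_undefended x (y := y) szL) => // i lti.
by rewrite foldr_scons ?size_map ?(nth_map y) /= ?szL.
Qed.

Theorem proposition1 (k : nat) :
  exists (P : program) (p : {poly nat}),
    forall F : argfw, in_degree_bounded F k ->
      answers_within (p.[af_size F])%R P (af_code F) (naive_bijective F).
Proof.
(* The negation is evaluated, so that 1 means naive-bijective; as [edges F] has [#|att F|] entries,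
   the bound is taken at [af_size F]. *)
have [P [p Pp]] := formula_decidable (Not (not_naive_bijective k)).
exists P, p => F degk; have [e] := Pp #|arg F| (edges F).
rewrite -[holds _ _ _ _]/(~~ holds _ (edge_rel (edges F)) e (not_naive_bijective k)).
by rewrite holds_not_naive_bijective // negbK -af_codeE size_map -cardE.
Qed.
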